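(* Let $\mathcal{H}=\mathcal{H}_1\times\cdots\times\mathcal{H}_m$ be a product of Hilbert spaces and let $S:\mathcal{H}\to\mathcal{H}$ be an operator such that $I-S$ is nonexpansive, $\operatorname{zer}(S)\neq\emptyset$, and, for some $\mu>0$, $$\langle Sx,x-x^*\rangle\ge\mu\|x-x^*\|^2\qquad\text{for all }x^*\in\operatorname{zer}(S),\ x\in\mathcal{H}.$$ Let $L=\max_{1\le i\le m}L_i$, where $L_i$ is the Lipschitz constant of the coordinate operator $S_i$. Let $(x^k)_{k\ge0}$ be generated by the Cyclic Coordinate Update algorithm from an arbitrary $x^0\in\mathcal{H}$, with an arbitrary ordering of the $m$ coordinates in each epoch, and with the fixed step size $\alpha_k\equiv\alpha$, $$\alpha=\min\left\{\frac{1}{4mL},\ \frac{\mu}{4\sqrt{2}\,mL},\ \frac{2mL}{17mL+2\mu^2}\right\}.$$ Then $x^k$ converges to $x^*\in\operatorname{zer}(S)$, and moreover, for all $k\ge 0$, $$\|x^k-x^*\|^2\le\rho^k\|x^0-x^*\|^2,\qquad \rho=1-\frac{\alpha\mu^2}{2}<1.$$ When $m$ and $L/\mu$ are large, $\alpha=O\!\left(\frac{\mu}{mL}\right)$, i.e. there are absolute constants $C,K>0$ such that $\alpha\le C\frac{\mu}{mL}$ whenever $m\ge K$ and $L/\mu\ge K$.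
   Context: $\mathcal{H}=\mathcal{H}_1\times\cdots\times\mathcal{H}_m$, where each $\mathcal{H}_i$ is a (real) Hilbert space, carries the product inner product $\langle\cdot,\cdot\rangle$ and the induced norm $\|\cdot\|$; $x=(x_1,\ldots,x_m)$ with $x_i\in\mathcal{H}_i$. $I$ is the identity. $I-S$ is nonexpansive means $\|(I-S)x-(I-S)y\|\le\|x-y\|$ for all $x,y\in\mathcal{H}$. $\operatorname{zer}(S)=\{x\in\mathcal{H}: Sx=0\}$. For $i=1,\ldots,m$ the $i$th coordinate operator $S_i:\mathcal{H}\to\mathcal{H}$ is $S_ix=(0,\ldots,0,(Sx)_i,0,\ldots,0)$ (the $i$th block of $Sx$ in position $i$, zeros elsewhere). $L_i$ satisfies $\|S_ix-S_iy\|\le L_i\|x-y\|$ for all $x,y\in\mathcal{H}$; since nonexpansiveness of $I-S$ makes $S$ (hence each $S_i$) 2-Lipschitz, $L\le2$. Cyclic Coordinate Update algorithm: given $x^0\in\mathcal{H}$, for each epoch $k=1,2,\ldots$, choose a permutation $(i_1,\ldots,i_m)$ of $(1,\ldots,m)$ (it may be any permutation and may differ from epoch to epoch) and a step size $\alpha_k>0$; set $y^0=x^{k-1}$; for $j=1,\ldots,m$ set $y^j=y^{j-1}-\alpha_kS_{i_j}(y^{j-1})$; finally set $x^k=y^m$. *)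

(* Defs.v *)
From HB Require Import structures.
From mathcomp Require Import all_boot all_order all_algebra perm.
From mathcomp Require Import sesquilinear ring lra.
From mathcomp Require Import all_classical all_reals all_analysis.

Set Implicit Arguments.
Unset Strict Implicit.
Unset Printing Implicit Defensive.

Import Order.TTheory GRing.Theory Num.Theory.
Import numFieldNormedType.Exports.

Local Open Scope classical_set_scope.
Local Open Scope ring_scope.

HB.mixin Record CompleteNormedModule_isHilbert (R : realType) V
    of CompleteNormedModule R V := {
  hinner : {dot V for (@idfun R)} ;
  sqr_normE : forall x : V, `|x| ^+ 2 = hinner x x
}.

#[short(type="hilbertType")]
HB.structure Definition Hilbert (R : realType) :=
  {V of CompleteNormedModule_isHilbert R V & CompleteNormedModule R V}.

Notation "''[' x , y ]" := (hinner x y)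
  (at level 0, format "''[' x ,  y ]") : ring_scope.

Section HilbertTheory.
Variables (R : realType) (V : hilbertType R).
Implicit Types (x y z : V) (a : R).

Lemma hinnerC x y : '[x, y] = '[y, x].
Proof. by rewrite hermC expr0 mul1r. Qed.

Lemma hinnerDl x y z : '[x + y, z] = '[x, z] + '[y, z].
Proof. by rewrite linearDl. Qed.

Lemma hinnerZl a x z : '[a *: x, z] = a * '[x, z].
Proof. by rewrite linearZl. Qed.

Lemma hinnerDr x y z : '[z, x + y] = '[z, x] + '[z, y].
Proof. by rewrite !(hinnerC z) hinnerDl. Qed.

Lemma hinnerZr a x z : '[z, a *: x] = a * '[z, x].
Proof. by rewrite !(hinnerC z) hinnerZl. Qed.

Lemma hinner_ge0 x : 0 <= '[x, x].
Proof. by rewrite -sqr_normE sqr_ge0. Qed.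

Lemma hinner_eq0 x : '[x, x] = 0 -> x = 0.
Proof.
by rewrite -sqr_normE => /eqP; rewrite sqrf_eq0 normr_eq0 => /eqP.
Qed.

Lemma norm_hinner x : `|x| = Num.sqrt '[x, x].
Proof. by rewrite -sqr_normE sqrtr_sqr normr_id. Qed.

End HilbertTheory.

(* H_1 x ... x H_m, kept apart from the plain function type so that it does
   not inherit the pointwise topology of the library *)
Definition hprod (R : realType) (m : nat) (H : 'I_m -> hilbertType R) : Type :=
  forall i, H i.

Section HilbertProduct.
Variables (R : realType) (m : nat) (H : 'I_m -> hilbertType R).
Local Notation P := (hprod H).

HB.instance Definition _ := gen_eqMixin P.
HB.instance Definition _ := gen_choiceMixin P.

Definition hprod_add (x y : P) : P := fun i => x i + y i.
Definition hprod_opp (x : P) : P := fun i => - x i.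
Definition hprod_zero : P := fun=> 0.
Definition hprod_scale (a : R) (x : P) : P := fun i => a *: x i.

Fact hprod_addA : associative hprod_add.
Proof. by move=> x y z; apply: functional_extensionality_dep => i; exact: addrA. Qed.
Fact hprod_addC : commutative hprod_add.
Proof. by move=> x y; apply: functional_extensionality_dep => i; exact: addrC. Qed.
Fact hprod_add0 : left_id hprod_zero hprod_add.
Proof. by move=> x; apply: functional_extensionality_dep => i; exact: add0r. Qed.
Fact hprod_addN : left_inverse hprod_zero hprod_opp hprod_add.
Proof. by move=> x; apply: functional_extensionality_dep => i; exact: addNr. Qed.

HB.instance Definition _ :=
  GRing.isZmodule.Build P hprod_addA hprod_addC hprod_add0 hprod_addN.

Fact hprod_scaleA a b (x : P) :
  hprod_scale a (hprod_scale b x) = hprod_scale (a * b) x.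
Proof. by apply: functional_extensionality_dep => i; exact: scalerA. Qed.
Fact hprod_scale1 : left_id 1 hprod_scale.
Proof. by move=> x; apply: functional_extensionality_dep => i; exact: scale1r. Qed.
Fact hprod_scaleDr : right_distributive hprod_scale +%R.
Proof. by move=> a x y; apply: functional_extensionality_dep => i; exact: scalerDr. Qed.
Fact hprod_scaleDl (x : P) : {morph hprod_scale^~ x : a b / a + b}.
Proof. by move=> a b; apply: functional_extensionality_dep => i; exact: scalerDl. Qed.

HB.instance Definition _ := GRing.Zmodule_isLmodule.Build R P
  hprod_scaleA hprod_scale1 hprod_scaleDr hprod_scaleDl.

Definition hprod_inner (x y : P) : R := \sum_i '[x i, y i].
Definition hprod_norm (x : P) : R := Num.sqrt (hprod_inner x x).

Let innC x y : hprod_inner x y = hprod_inner y x.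
Proof. by apply: eq_bigr => i _; exact: hinnerC. Qed.
Let innDl x y z : hprod_inner (x + y) z = hprod_inner x z + hprod_inner y z.
Proof. by rewrite -big_split; apply: eq_bigr => i _; exact: hinnerDl. Qed.
Let innZl a x z : hprod_inner (a *: x) z = a * hprod_inner x z.
Proof. by rewrite mulr_sumr; apply: eq_bigr => i _; exact: hinnerZl. Qed.
Let innDr x y z : hprod_inner z (x + y) = hprod_inner z x + hprod_inner z y.
Proof. by rewrite !(innC z) innDl. Qed.
Let innZr a x z : hprod_inner z (a *: x) = a * hprod_inner z x.
Proof. by rewrite !(innC z) innZl. Qed.
Let inn_ge0 x : 0 <= hprod_inner x x.
Proof. by apply: sumr_ge0 => i _; exact: hinner_ge0. Qed.
Let inn_eq0 x : hprod_inner x x = 0 -> x = 0.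
Proof.
move=> /eqP; rewrite psumr_eq0 => [/allP x0|i _]; last exact: hinner_ge0.
apply: functional_extensionality_dep => i.
by apply: hinner_eq0; apply/eqP; apply: x0; rewrite mem_index_enum.
Qed.

Let inn_CS x y :
  hprod_inner x y ^+ 2 <= hprod_inner x x * hprod_inner y y.
Proof.
set p := hprod_inner y y; set q := hprod_inner x y.
have [y0|p0] := eqVneq p 0.
  suff -> : q = 0 by rewrite expr0n /= y0 mulr0.
  by rewrite /q (inn_eq0 y0) -[0 in LHS](scale0r (0 : P)) innZr mul0r.
have pgt0 : 0 < p by rewrite lt_def p0 inn_ge0.
have := inn_ge0 (p *: x + (- q) *: y).
rewrite innDl !innDr !innZl !innZr (innC y x) -/p -/q => h.
rewrite -subr_ge0 -(pmulr_rge0 _ pgt0).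
by apply: le_trans h _; rewrite le_eqVlt; apply/orP; left; apply/eqP; ring.
Qed.

Fact hprod_normD x y : hprod_norm (x + y) <= hprod_norm x + hprod_norm y.
Proof.
rewrite -(@ler_pXn2r _ 2) ?nnegrE ?addr_ge0 ?sqrtr_ge0//.
rewrite sqrrD !sqr_sqrtr ?inn_ge0// innDl !innDr (innC y x).
suff : hprod_inner x y <= hprod_norm x * hprod_norm y by lra.
rewrite -sqrtrM ?inn_ge0//; apply: le_trans (ler_norm _) _.
by rewrite -sqrtr_sqr ler_wsqrtr.
Qed.

Fact hprod_normZ a x : hprod_norm (a *: x) = `|a| * hprod_norm x.
Proof.
rewrite /hprod_norm innZl innZr mulrA -expr2 sqrtrM ?sqr_ge0//.
by rewrite sqrtr_sqr.
Qed.

Fact hprod_norm0_eq0 x : hprod_norm x = 0 -> x = 0.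
Proof.
by move=> /eqP; rewrite sqrtr_eq0 => h; apply/inn_eq0/le_anti; rewrite h inn_ge0.
Qed.

HB.instance Definition _ :=
  Lmodule_isNormed.Build R P hprod_normD hprod_normZ hprod_norm0_eq0.

Fact hprod_sqr_normE (x : P) : `|x| ^+ 2 = hprod_inner x x.
Proof. by rewrite sqr_sqrtr// inn_ge0. Qed.

Lemma norm_coord_le (x : P) i : `|x i| <= `|x|.
Proof.
rewrite -(@ler_pXn2r _ 2) ?nnegrE// hprod_sqr_normE sqr_normE.
by rewrite /hprod_inner (bigD1 i)//= lerDl sumr_ge0// => j _; exact: hinner_ge0.
Qed.

Lemma norm_le_sum_coord (x : P) : `|x| <= \sum_i `|x i|.
Proof.
rewrite -(@ler_pXn2r _ 2) ?nnegrE ?sumr_ge0// hprod_sqr_normE expr2 mulr_suml.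
apply: ler_sum => i _; rewrite -sqr_normE expr2 ler_wpM2l//.
by rewrite (bigD1 i)//= lerDl sumr_ge0.
Qed.

Fact hprod_complete (F : set_system P) : ProperFilter F -> cauchy F -> cvg F.
Proof.
move=> FF /cauchy_ballP Fc.
have Fi i : cvg ((fun x : P => x i) @ F).
  apply: cauchy_cvg; apply/cauchy_ballP => e e0; near_simpl.
  apply: filterS (Fc e e0) => -[x y]; rewrite -!ball_normE /=.
  exact/le_lt_trans/(norm_coord_le (x - y)).
pose l : P := fun i => lim ((fun x : P => x i) @ F).
apply/cvg_ex; exists l; apply/cvgrPdist_lt => e e0.
have e'0 : 0 < e / m.+1%:R by rewrite divr_gt0.
have : \forall x \near F, forall i, `|l i - x i| < e / m.+1%:R.
  by apply: filter_forall => i; have /cvgrPdist_lt := Fi i; exact.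
apply: filterS => x xl; apply: le_lt_trans (norm_le_sum_coord _) _.
apply: (@le_lt_trans _ _ (\sum_(i < m) (e / m.+1%:R))).
  by apply: ler_sum => i _; exact/ltW/xl.
rewrite sumr_const card_ord -[X in X < _]mulr_natr -mulrA gtr_pMr// mulrC.
by rewrite ltr_pdivrMr// mul1r ltr_nat.
Qed.

HB.instance Definition _ := Uniform_isComplete.Build P hprod_complete.

Fact hprod_inner_bilinear :
  bilinear_for *%R ((@idfun R) \; *%R) hprod_inner.
Proof.
by split=> [y a x x'|x a y y'] /=; rewrite ?innDl ?innZl ?innDr ?innZr.
Qed.

HB.instance Definition _ := bilinear_isBilinear.Build R P P R
  *%R ((@idfun R) \; *%R) hprod_inner hprod_inner_bilinear.

HB.instance Definition _ := isHermitianSesquilinear.Build R P false idfun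
  hprod_inner (fun x y => etrans (innC x y) (esym (mul1r _))).

Fact hprod_inner_gt0 (x : P) : x != 0 -> 0 < hprod_inner x x.
Proof. by move=> x0; rewrite -hprod_sqr_normE exprn_gt0// normr_gt0. Qed.

HB.instance Definition _ := isDotProduct.Build R P hprod_inner hprod_inner_gt0.

HB.instance Definition _ :=
  CompleteNormedModule_isHilbert.Build R P hprod_sqr_normE.

End HilbertProduct.

Section CyclicCoordinateUpdate.
Variables (R : realType) (m : nat) (H : 'I_m -> hilbertType R).
Implicit Types (S T : hprod H -> hprod H) (x : hprod H).

Definition nonexpansive T := forall x y, `|T x - T y| <= `|x - y|.

Definition zer S : set (hprod H) := [set x | S x = 0].

Definition coord_op S (i : 'I_m) : hprod H -> hprod H :=
  fun x j => if j == i then S x j else 0.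

(* the coordinates are visited in the order s 0, s 1, ..., s (m - 1) *)
Definition ccu_epoch S (a : R) (s : 'S_m) x : hprod H :=
  foldl (fun y i => y - a *: coord_op S i y) x [seq s j | j <- enum 'I_m].

(* epochs are numbered from 1: alpha 0 and sigma 0 are not used *)
Fixpoint ccu S (alpha : nat -> R) (sigma : nat -> 'S_m) x0 (k : nat) : hprod H :=
  if k is k'.+1 then
    ccu_epoch S (alpha k) (sigma k) (ccu S alpha sigma x0 k')
  else x0.

End CyclicCoordinateUpdate.

Definition ccu_step (R : realType) (m : nat) (mu L : R) : R :=
  Num.min (1 / (4 * m%:R * L))
    (Num.min (mu / (4 * Num.sqrt 2 * m%:R * L))
             (2 * m%:R * L / (17 * m%:R * L + 2 * mu ^+ 2))).

(* Main.v *)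
Require Import Defs.
From HB Require Import structures.
From mathcomp Require Import all_boot all_order all_algebra perm.
From mathcomp Require Import all_classical all_reals all_analysis.
From mathcomp Require Import ring lra.

Set Implicit Arguments.
Unset Strict Implicit.
Unset Printing Implicit Defensive.

Import Order.TTheory GRing.Theory Num.Theory.
Import numFieldNormedType.Exports.

Local Open Scope classical_set_scope.
Local Open Scope ring_scope.

(** The proof compares one epoch with a full step of the operator.  Every
coordinate is updated exactly once per epoch, so an epoch is
[x' = x - a *: u] where block [i] of [u] is block [i] of [S] at some
intermediate point [p i].  That point lies between [x] and [x']: each of its
coordinates has either been updated already or not, and coordinate [i] has not.
Hence [`|p i - x|^2 <= a^2 (`|u|^2 - `|u i|^2)], and summing the Lipschitz
bounds of the blocks gives
[`|u - S x|^2 <= (m - 1) (a L)^2 `|u|^2] ([ccu_epoch_direction]).  Since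
[4 (m - 1) <= m^2], this reads [8 `|u - S x| <= c `|u|] with [c = 4 m L a], and
the step size makes [c] at most [1] and at most [mu].

Put [e = x - xs], so that [`|x' - xs|^2 = `|e|^2 - 2 a '[u, e] + a^2 `|u|^2].
Nonexpansiveness of [I - S] gives [2 '[S x, e] >= `|S x|^2], and the
monotonicity bound with Cauchy-Schwarz gives [mu `|e| <= `|S x|].  From [c <= 1],
[`|u| <= 8/7 `|S x|]; from [c <= mu],
[`|u - S x| `|e| <= mu `|e| `|u| / 8 <= `|S x|^2 / 7]; and [a <= 2/17] handles
the quadratic term.  In units of [a `|S x|^2] the decrease is at least
[1 - 2/7 - (2/17) (64/49) > 1/2], and [`|S x|^2 >= mu^2 `|e|^2] turns it into
the factor [1 - a mu^2 / 2] ([ccu_epoch_contracts]).  Iterating the contraction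
gives the rate and the convergence ([geometric_decay]).

The asymptotic size of the step is read off its second entry, which is below
[mu / (m L)]. *)

(** * Norm and inner product *)

Section HilbertNorm.
Variables (R : realType) (V : hilbertType R).
Implicit Types x y : V.

Lemma sqr_normB x y : `|x - y| ^+ 2 = `|x| ^+ 2 - 2 * '[x, y] + `|y| ^+ 2.
Proof.
rewrite !sqr_normE -scaleN1r hinnerDl !hinnerDr !hinnerZl !hinnerZr (hinnerC y x).
by ring.
Qed.

(** Cauchy-Schwarz; here it is the triangle inequality for [x + y], squared. *)
Lemma hinner_le_norm x y : '[x, y] <= `|x| * `|y|.
Proof.
have : `|x - - y| ^+ 2 <= (`|x| + `|y|) ^+ 2.
  by rewrite opprK ler_pXn2r ?nnegrE ?addr_ge0// ler_normD.
rewrite sqr_normB normrN -[- y]scaleN1r hinnerZr.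
by lra.
Qed.

End HilbertNorm.

(** * Geometric decay *)

(** No lower bound on [rho] is assumed: a negative [rho] forces [a] to vanish.
For the iteration this happens when all the factors are zero spaces, where
[mu] can be arbitrarily large. *)
Lemma geometric_decay (R : realType) (a : R^nat) (rho : R) :
  (forall k, 0 <= a k) -> (forall k, a k.+1 <= rho * a k) -> rho < 1 ->
  (forall k, a k <= rho ^+ k * a 0%N) /\ a @ \oo --> (0 : R).
Proof.
move=> a0 arho rho1.
have powq q : 0 <= q -> rho <= q -> forall k, a k <= q ^+ k * a 0%N.
  move=> q0 rhoq; elim=> [|k IH]; first by rewrite expr0 mul1r.
  rewrite exprS -mulrA; apply: le_trans (arho k) _.
  by apply: le_trans (ler_wpM2r (a0 k) rhoq) _; exact: ler_wpM2l.
split=> [k|].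
  have [rho0|rho0] := leP 0 rho; first exact: powq.
  have ak0 n : a n = 0.
    apply/eqP; rewrite eq_le a0 andbT leNgt; apply/negP => an0.
    have := le_trans (a0 n.+1) (arho n).
    by rewrite leNgt nmulr_rlt0// an0.
  by rewrite !ak0 mulr0.
(* the clamped rate is a nonnegative rate below 1, so its powers tend to 0 *)
pose q := Num.max 0 rho.
have q0 : 0 <= q by rewrite le_max lexx.
have qpow : (fun k => q ^+ k * a 0%N) @ \oo --> (0 : R).
  rewrite -[X in _ --> X](mul0r (a 0%N)); apply: cvgMr_tmp.
  by apply: cvg_expr; rewrite ger0_norm// gt_max ltr01.
apply: (@squeeze_cvgr _ _ _ _ (fun=> 0) (fun k => q ^+ k * a 0%N)).
- by apply: nearW => k; rewrite a0 powq// le_max lexx orbT.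
- exact: cvg_cst.
- exact: qpow.
Qed.

(** * One epoch *)

Section Epoch.
Variables (R : realType) (m : nat) (H : 'I_m -> hilbertType R).
Variable S : hprod H -> hprod H.
Implicit Types (x y z u : hprod H) (a L mu : R).

Lemma hprod_sqr_norm x : `|x| ^+ 2 = \sum_i `|x i| ^+ 2.
Proof.
by rewrite hprod_sqr_normE; apply: eq_bigr => i _; rewrite sqr_normE.
Qed.

(** The witness [p i] is the iterate at which coordinate [i] is read.  The third
property holds because nothing writes coordinate [i] before its own turn, and
the fourth because each coordinate is written at most once, so that it only ever
takes its initial and its final value.  Coordinates outside [l] are covered for
the sake of the induction on [l]. *)
Lemma foldl_coord_reads a (l : seq 'I_m) x : uniq l ->
  let z := foldl (fun y i => y - a *: coord_op S i y) x l in
  exists p : 'I_m -> hprod H,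
    [/\ forall i, i \notin l -> z i = x i,
        forall i, i \in l -> z i = x i - a *: S (p i) i,
        forall i, i \in l -> p i i = x i
      & forall i, i \in l -> forall j, p i j = x j \/ p i j = z j].
Proof.
elim: l x => [|i l IH] x /=; first by move=> _; exists (fun=> x).
move=> /andP[il ul]; set y := x - a *: coord_op S i x.
have yi : y i = x i - a *: S x i.
  by rewrite /y /= /GRing.add /= /hprod_add /GRing.opp /= /hprod_opp
    /GRing.scale /= /hprod_scale /coord_op eqxx.
have yE j : j != i -> y j = x j.
  move=> ji; rewrite /y /GRing.add /= /hprod_add /GRing.opp /= /hprod_opp.
  rewrite /GRing.scale /= /hprod_scale /coord_op (negbTE ji).
  by rewrite scaler0 subr0.
have [p [zN zl pl pz]] := IH y ul.
set z := foldl _ _ _ in zN zl pl pz *.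
have li j : j \in l -> j != i by move=> jl; apply: contraNneq il => <-.
exists (fun k => if k == i then x else p k); split.
- move=> j; rewrite inE negb_or => /andP[ji jl].
  by rewrite zN// yE.
- move=> j; rewrite inE; case: eqVneq => [->|ji] /= jl.
    by rewrite zN.
  by rewrite zl// yE.
- move=> j; rewrite inE; case: eqVneq => [->|ji] //= jl.
  by rewrite pl// yE.
- move=> j; rewrite inE; case: eqVneq => [->|ji] /= jl k; first by left.
  have [->|ki] := eqVneq k i; last by rewrite -(yE k ki); exact: pz.
  by right; case: (pz j jl i) => ->//; rewrite zN.
Qed.

Lemma ccu_epoch_reads a (s : 'S_m) x :
  exists p : 'I_m -> hprod H, forall i,
    [/\ ccu_epoch S a s x i = x i - a *: S (p i) i,
        p i i = x i
      & forall j, p i j = x j \/ p i j = ccu_epoch S a s x j].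
Proof.
have ul : uniq [seq s j | j <- enum 'I_m].
  by rewrite map_inj_uniq ?enum_uniq//; exact: perm_inj.
have al i : i \in [seq s j | j <- enum 'I_m].
  by apply/mapP; exists (s^-1%g i); rewrite ?mem_enum ?permKV.
have [p [_ zl pl pz]] := foldl_coord_reads a x ul.
by exists p => i; split; [exact: zl|exact: pl|exact: pz].
Qed.

(** The factor [m - 1], rather than [m], is what leaves enough room for the
constants of the step size; in particular the epoch is an exact step of [S]
when [m = 1]. *)
Lemma ccu_epoch_direction a L (s : 'S_m) x :
    (forall i, L.-lipschitz (coord_op S i)) ->
  exists u, ccu_epoch S a s x = x - a *: u /\
    `|u - S x| ^+ 2 <= L ^+ 2 * (a ^+ 2 * ((m%:R - 1) * `|u| ^+ 2)).
Proof.
move=> Llip; have [p pP] := ccu_epoch_reads a s x.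
pose u : hprod H := fun i => S (p i) i.
have zE : ccu_epoch S a s x = x - a *: u.
  by apply: functional_extensionality_dep => i; case: (pP i).
exists u; split=> //.
have sumE : (m%:R - 1) * `|u| ^+ 2 = \sum_i (`|u| ^+ 2 - `|u i| ^+ 2).
  rewrite sumrB -(hprod_sqr_norm u) sumr_const card_ord -[X in _ = X - _]mulr_natl.
  by rewrite mulrBl mul1r.
rewrite hprod_sqr_norm sumE !mulr_sumr.
apply: ler_sum => i _.
(* [p i - x] is supported on the coordinates updated before [i], where it equals
   [- a *: u] *)
have px : `|p i - x| ^+ 2 <= a ^+ 2 * (`|u| ^+ 2 - `|u i| ^+ 2).
  rewrite !hprod_sqr_norm [X in _ * (X - _)](bigD1 i)//= addrC addrK.
  rewrite (bigD1 i)//=; have [_ pii pij] := pP i.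
  have -> : (p i - x) i = 0 by rewrite -[LHS]/(p i i - x i) pii subrr.
  rewrite normr0 expr0n add0r mulr_sumr; apply: ler_sum => j _.
  rewrite -[(p i - x) j]/(p i j - x j).
  case: (pij j) => ->; first by rewrite subrr normr0 expr0n mulr_ge0 ?sqr_ge0.
  rewrite zE -[(x - a *: u) j]/(x j - a *: u j) addrAC subrr add0r normrN.
  by rewrite normrZ exprMn real_normK ?num_real.
have dS : `|(u - S x) i| <= L * `|p i - x|.
  have := Llip i (p i, x) (conj I I); rewrite /=; apply: le_trans.
  apply: le_trans (norm_coord_le _ i).
  rewrite -[(coord_op S i (p i) - coord_op S i x) i]/
    (coord_op S i (p i) i - coord_op S i x i).
  by rewrite /coord_op eqxx.
apply: (@le_trans _ _ ((L * `|p i - x|) ^+ 2)).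
  by rewrite ler_pXn2r ?nnegrE// (le_trans _ dS).
by rewrite exprMn ler_wpM2l ?sqr_ge0.
Qed.

(** The three upper bounds on [a] have separate roles: [2 / 17] controls the
quadratic term, [4 m L a <= 1] compares [u] with [S x], and [4 m L a <= mu]
absorbs the cross term [`|u - S x| `|e|]. *)
Lemma ccu_epoch_contracts a mu L (s : 'S_m) x xs :
  nonexpansive (fun x => x - S x) ->
  (forall i, L.-lipschitz (coord_op S i)) ->
  zer S xs ->
  mu * `|x - xs| ^+ 2 <= '[S x, x - xs] ->
  0 <= L -> 0 <= a -> 0 <= mu ->
  a <= 2 / 17 -> 4 * m%:R * L * a <= 1 -> 4 * m%:R * L * a <= mu ->
  `|ccu_epoch S a s x - xs| ^+ 2 <= (1 - a * mu ^+ 2 / 2) * `|x - xs| ^+ 2.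
Proof.
move=> nonexp Llip xs0 monS L0 a0 mu0 a217 c1 cmu.
have [u [-> dP]] := ccu_epoch_direction a s x Llip.
set c := 4 * m%:R * L * a in c1 cmu.
have c0 : 0 <= c by rewrite !mulr_ge0.
set e := x - xs in monS *.
have -> : x - a *: u - xs = e - a *: u by rewrite /e addrAC.
(* nonexpansiveness of [I - S] makes [S] cocoercive towards its zeros *)
have coco : `|S x| ^+ 2 <= 2 * '[S x, e].
  have := nonexp x xs.
  have -> : x - S x - (xs - S xs) = e - S x.
    by rewrite xs0 subr0 /e addrAC.
  rewrite -/e -(@ler_pXn2r _ 2) ?nnegrE// sqr_normB (hinnerC e).
  by lra.
(* square both sides and use [4 (m - 1) <= m^2] *)
have d8 : 8 * `|u - S x| <= c * `|u|.
  rewrite -(@ler_pXn2r _ 2) ?nnegrE ?mulr_ge0// !exprMn.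
  have m4 : 4 * (m%:R - 1) <= m%:R ^+ 2 :> R.
    by have := sqr_ge0 (m%:R - 2 : R); nra.
  have : 0 <= (L ^+ 2 * a ^+ 2 * `|u| ^+ 2) * (m%:R ^+ 2 - 4 * (m%:R - 1)).
    by rewrite !mulr_ge0 ?sqr_ge0// subr_ge0.
  by rewrite /c; move: dP; lra.
have du : `|u| <= `|S x| + `|u - S x|.
  by rewrite -[X in `|X| <= _](subrKC (S x)) ler_normD.
have ue : '[u, e] >= '[S x, e] - `|u - S x| * `|e|.
  have := hinner_le_norm (S x - u) e.
  rewrite distrC -scaleN1r hinnerDl hinnerZl; lra.
have mue : mu * `|e| <= `|S x|.
  have [->|e0] := eqVneq `|e| 0; first by rewrite mulr0.
  have ep : 0 < `|e| by rewrite lt_def e0 normr_ge0.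
  rewrite -(ler_pM2r ep) -mulrA -expr2.
  exact: le_trans monS (hinner_le_norm _ _).
rewrite sqr_normB hinnerZr (hinnerC e) normrZ (ger0_norm a0).
move: (normr_ge0 e) (normr_ge0 (S x)) (normr_ge0 u) (normr_ge0 (u - S x)).
move: coco d8 du ue mue; clear - a0 mu0 a217 c0 c1 cmu.
set E := `|e|; set s' := `|S x|; set U := `|u|; set d := `|u - S x|.
set q := '[u, e]; set r := '[S x, e].
move=> coco d8 du ue mue E0 s0 U0 d0.
have dU : 8 * d <= U by apply: le_trans d8 _; rewrite ler_piMl.
have Us : U <= 8 / 7 * s' by lra.
have dE : d * E <= s' ^+ 2 / 7.
  have h1 : 8 * d * E <= c * U * E by rewrite ler_wpM2r.
  have h2 : c * U * E <= (mu * E) * U by rewrite mulrAC ler_wpM2r// ler_wpM2r.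
  have h3 : (mu * E) * U <= s' * (8 / 7 * s').
    by apply: ler_pM => //; exact: mulr_ge0.
  by move: (le_trans (le_trans h1 h2) h3); rewrite expr2; lra.
have q5 : 5 / 14 * s' ^+ 2 <= q by lra.
have U2 : U ^+ 2 <= 64 / 49 * s' ^+ 2.
  have -> : 64 / 49 * s' ^+ 2 = (8 / 7 * s') ^+ 2 by field.
  by rewrite ler_pXn2r ?nnegrE// mulr_ge0.
have E2 : mu ^+ 2 * E ^+ 2 <= s' ^+ 2.
  by rewrite -exprMn ler_pXn2r ?nnegrE ?mulr_ge0.
have aU : a * U ^+ 2 <= 2 / 17 * (64 / 49 * s' ^+ 2).
  by apply: ler_pM => //; exact: sqr_ge0.
have s2 : 0 <= s' ^+ 2 by exact: sqr_ge0.
(* [5/7 - (2/17) (64/49) >= 1/2] *)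
have key : 0 <= a * (2 * q - a * U ^+ 2 - mu ^+ 2 * E ^+ 2 / 2).
  by apply: mulr_ge0 => //; lra.
by move: key; lra.
Qed.

End Epoch.

(** * The step size *)

Lemma ccu_step_bounds (R : realType) (m : nat) (mu L : R) :
  (0 < m)%N -> 0 < mu -> 0 < L ->
  [/\ 0 < ccu_step m mu L,
      ccu_step m mu L <= 2 / 17,
      4 * m%:R * L * ccu_step m mu L <= 1 &
      4 * m%:R * L * ccu_step m mu L <= mu].
Proof.
move=> m0 mu0 L0; have mR : 0 < m%:R :> R by rewrite ltr0n.
have mL : 0 < m%:R * L by rewrite mulr_gt0.
have c0 : 0 < 4 * m%:R * L by rewrite -mulrA mulr_gt0.
have r2 : 1 <= Num.sqrt 2 :> R by rewrite -[X in X <= _]sqrtr1 ler_wsqrtr// ler1n.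
have r0 : 0 < Num.sqrt 2 :> R by apply: lt_le_trans r2.
have b0 : 0 < 4 * Num.sqrt 2 * m%:R * L.
  by rewrite -mulrA mulr_gt0// mulr_gt0.
have t0 : 0 < 17 * m%:R * L + 2 * mu ^+ 2.
  by rewrite -mulrA addr_gt0 ?mulr_gt0 ?exprn_gt0.
rewrite /ccu_step; split.
- by rewrite !lt_min !divr_gt0// -mulrA mulr_gt0.
- rewrite !ge_min; apply/orP; right; apply/orP; right.
  rewrite ler_pdivrMr//; have : 0 <= mu ^+ 2 by exact: sqr_ge0.
  by lra.
- rewrite mulrC -ler_pdivlMr// ge_min; apply/orP; left.
  by rewrite lexx.
- rewrite mulrC -ler_pdivlMr// !ge_min; apply/orP; right; apply/orP; left.
  rewrite ler_pM2l// lef_pV2 ?posrE// -!mulrA ler_pM2l//.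
  by rewrite ler_peMl// ltW.
Qed.

(** * Convergence *)

Theorem theorem3p6 (R : realType) :
  (forall (m : nat) (H : 'I_m -> hilbertType R) (S : hprod H -> hprod H)
      (mu : R) (Li : 'I_m -> R) (sigma : nat -> 'S_m) (x0 : hprod H),
    (0 < m)%N ->
    nonexpansive (fun x => x - S x) ->
    zer S !=set0 ->
    0 < mu ->
    (forall xs x : hprod H, zer S xs ->
      mu * `|x - xs| ^+ 2 <= '[S x, x - xs]) ->
    (forall i, (Li i).-lipschitz (coord_op S i)) ->
    let L := \big[Num.max/0]_(i < m) Li i in
    0 < L ->
    let alpha := ccu_step m mu L in
    let rho := 1 - alpha * mu ^+ 2 / 2 in
    let x := ccu S (fun=> alpha) sigma x0 in
    rho < 1 /\
    exists xs : hprod H,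
      [/\ zer S xs,
          x @ \oo --> xs &
          forall k, `|x k - xs| ^+ 2 <= rho ^+ k * `|x 0%N - xs| ^+ 2]) /\
  (exists C K : R,
    [/\ 0 < C, 0 < K &
        forall (m : nat) (mu L : R), 0 < mu -> 0 < L ->
          K <= m%:R -> K <= L / mu ->
          ccu_step m mu L <= C * (mu / (m%:R * L))]).
Proof.
split=> [m H S mu Li sigma x0 m0 nonexp [xs xs0] mu0 monS Llip L L0 alpha rho x|].
  have [al0 al1 al2 al3] := ccu_step_bounds m0 mu0 L0.
  have rho1 : rho < 1.
    by rewrite /rho ltrBlDr ltrDl divr_gt0// mulr_gt0// exprn_gt0.
  split=> //; exists xs.
  have LL i : L.-lipschitz (coord_op S i).
    move=> yz _; apply: le_trans (Llip i yz (conj I I)) _.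
    by rewrite ler_wpM2r// le_bigmax.
  have step k : `|x k.+1 - xs| ^+ 2 <= rho * `|x k - xs| ^+ 2.
    by apply: (@ccu_epoch_contracts _ _ _ _ _ _ L) => //;
      [exact: monS|exact: ltW|exact: ltW|exact: ltW].
  have [dec lim0] := geometric_decay
    (fun k => sqr_ge0 `|x k - xs|) step rho1.
  split=> //; apply/cvgrPdist_lt => eps eps0.
  have e20 : 0 < eps ^+ 2 by rewrite exprn_gt0.
  have /cvgrPdist_lt/(_ _ e20) := lim0; apply: filterS => k.
  rewrite sub0r normrN ger0_norm ?sqr_ge0// distrC.
  by rewrite ltr_pXn2r ?nnegrE// ltW.
exists 1, 1; split=> // m mu L mu0 L0 m1 _.
have m0 : (0 < m)%N by rewrite -(ltr0n R) (lt_le_trans _ m1).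
have [s0 _ _ h] := ccu_step_bounds m0 mu0 L0.
have mL : 0 < m%:R * L by rewrite mulr_gt0// ltr0n.
rewrite mul1r ler_pdivlMr//; apply: le_trans h.
have : 0 <= ccu_step m mu L * (m%:R * L) by rewrite mulr_ge0 ?ltW.
by lra.
Qed.
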